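(* Let $\mathcal{P}$ be a nonempty finite collection of cells of $\mathbb{N}^2$. Then $\mathcal{P}$ is a parallelogram polyomino if and only if, up to translation, $\mathcal{P}$ is a simple planar distributive lattice, meaning that (after translation) $L=V(\mathcal{P})$ with the componentwise order is a simple planar distributive lattice and $\mathcal{P}$ is the collection of all cells whose four vertices lie in $L$.
   Context: $\mathbb{N}=\{0,1,2,\dots\}$. A cell is a set $[a,a+(1,1)]=\{a,a+(1,0),a+(0,1),a+(1,1)\}$ with $a\in\mathbb{N}^2$; these four points are its vertices. $V(\mathcal{P})$ is the set of all vertices of cells of $\mathcal{P}$. **Parallelogram polyominoes.** A north-east path is a sequence of points of $\mathbb{N}^2$ in which each consecutive pair is an east step $(a,b),(a+1,b)$ or a north step $(a,b),(a,b+1)$. Let $\mathcal{S}_1:(a_0,b_0),\dots,(a_k,b_k)$ and $\mathcal{S}_2:(c_0,d_0),\dots,(c_k,d_k)$ be north-east paths with the same first point and the same last point. $\mathcal{S}_1$ lies above $\mathcal{S}_2$ if for all $1\le i,j\le k-1$ we have $b_i>d_j$ whenever $a_i=c_j$ (so the two paths meet only at their endpoints, $\mathcal S_1$ starts with a north step and $\mathcal S_2$ with an east step). The parallelogram polyomino $\mathcal{P}=(\mathcal{S}_1,\mathcal{S}_2)$ is the collection of cells in the region bounded above by $\mathcal{S}_1$ and below by $\mathcal{S}_2$. **Planar distributive lattices.** Order $\mathbb{N}^2$ by $(i,j)\le(k,l)$ iff $i\le k$ and $j\le l$; this is a distributive lattice with componentwise max and min. A finite sublattice $L$ of $\mathbb{N}^2$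 is a planar distributive lattice if $(0,0)\in L$ and for any $(i,j)<(k,l)$ in $L$ there is a chain $(i,j)=(i_0,j_0)<(i_1,j_1)<\dots<(i_s,j_s)=(k,l)$ in $L$ with $i_{q+1}+j_{q+1}=i_q+j_q+1$ for all $q$. The rank of $a\in L$ is the maximum length (number of elements minus one) of a chain in $L$ descending from $a$; $\operatorname{rank}(L)$ is the maximum length of a chain in $L$. A planar distributive lattice $L$ is simple if for every $0<r<\operatorname{rank}(L)$ there are at least two elements of $L$ of rank $r$. *)

(* Defs.v *)
From mathcomp Require Import all_boot all_order.
From mathcomp Require Import finmap.

Set Implicit Arguments.
Unset Strict Implicit.
Unset Printing Implicit Defensive.

Import Order.Theory.

Local Open Scope fset_scope.
Local Open Scope nat_scope.

(* MathComp's product order on pairs: (p <= q)%O is componentwise, [Order.meet]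
   and [Order.join] are the componentwise min and max. *)
Notation point := (nat *p nat)%type.

Definition origin : point := (0, 0).

Definition shift (u a : point) : point := (u.1 + a.1, u.2 + a.2).

(* The cell [a, a + (1,1)] is encoded by its lower left corner a, so a finite
   collection of cells is a P : {fset point}. *)
Definition cell_vertices (a : point) : {fset point} :=
  [fset a; shift (1, 0) a; shift (0, 1) a; shift (1, 1) a].

Definition vertices (P : {fset point}) : {fset point} :=
  \bigcup_(a <- P) cell_vertices a.

(* Q = P + (u - v), a translation by a vector of Z^2. *)
Definition translates (P Q : {fset point}) : Prop :=
  exists u v : point, [fset shift u a | a in P] = [fset shift v b | b in Q].

Definition ne_step (p q : point) : bool :=
  (q == shift (1, 0) p) || (q == shift (0, 1) p).

Definition ne_path (S : seq point) : bool := (S != [::]) && sorted ne_step S.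

(* Paths with at most one step, and the pairs (E N^m, N^m E), satisfy this
   vacuously, but no cell lies between them. Otherwise S1 starts with a north
   step, S2 starts with an east step, and they meet only at their endpoints. *)
Definition lies_above (S1 S2 : seq point) : Prop :=
  forall i j : nat,
    0 < i < (size S1).-1 -> 0 < j < (size S2).-1 ->
    (nth origin S1 i).1 = (nth origin S2 j).1 ->
    (nth origin S1 i).2 > (nth origin S2 j).2.

Definition parallelogram_paths (S1 S2 : seq point) : Prop :=
  [/\ ne_path S1 /\ ne_path S2,
      size S1 = size S2,
      head origin S1 = head origin S2,
      last origin S1 = last origin S2
    & lies_above S1 S2].

(* S runs along the segment [x, x + 1] x {h}. *)
Definition east_step_at (S : seq point) (x h : nat) : bool :=
  infix [:: (x, h) : point; (x.+1, h) : point] S.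

(* The unit square with lower left corner a lies below the part of S1, and
   above the part of S2, in the vertical strip [a.1, a.1 + 1] x R. *)
Definition cell_between (S1 S2 : seq point) (a : point) : Prop :=
  exists h1 h2 : nat,
    [/\ east_step_at S1 a.1 h1, east_step_at S2 a.1 h2,
        h2 <= a.2 & a.2.+1 <= h1].

Definition parallelogram_polyomino (P : {fset point}) : Prop :=
  exists S1 S2 : seq point,
    parallelogram_paths S1 S2 /\
    forall a : point, a \in P <-> cell_between S1 S2 a.

Definition sublattice (L : {fset point}) : Prop :=
  forall p q : point, p \in L -> q \in L ->
    Order.meet p q \in L /\ Order.join p q \in L.

Definition unit_lt (p q : point) : bool :=
  (p < q)%O && (q.1 + q.2 == p.1 + p.2 + 1).

Definition planar_distributive_lattice (L : {fset point}) : Prop :=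
  [/\ sublattice L,
      origin \in L
    & forall p q : point, p \in L -> q \in L -> (p < q)%O ->
        exists s : seq point,
          [/\ path unit_lt p s, last p s = q & all (fun x => x \in L) s]].

Definition chain (C : {fset point}) : bool :=
  [forall p : C, [forall q : C, (val p >=< val q)%O]].

Definition descends_from (a : point) (C : {fset point}) : bool :=
  (a \in C) && [forall p : C, (val p <= a)%O].

Definition chain_length (C : {fset point}) : nat := #|` C|.-1.

Definition elt_rank (L : {fset point}) (a : point) : nat :=
  \max_(C <- fpowerset L | chain C && descends_from a C) chain_length C.

Definition lattice_rank (L : {fset point}) : nat :=
  \max_(C <- fpowerset L | chain C) chain_length C.

Definition simple_lattice (L : {fset point}) : Prop :=
  forall r : nat, 0 < r < lattice_rank L ->
    2 <= #|` [fset a in L | elt_rank L a == r]|.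

Definition simple_planar_distributive_lattice (L : {fset point}) : Prop :=
  planar_distributive_lattice L /\ simple_lattice L.

(* P is identified with the lattice L = V(P). *)
Definition is_simple_planar_distributive_lattice (P : {fset point}) : Prop :=
  simple_planar_distributive_lattice (vertices P) /\
  forall a : point, a \in P <-> cell_vertices a `<=` vertices P.

(* Main.v *)
Require Import Defs.
From mathcomp Require Import all_boot all_order.
From mathcomp Require Import finmap zify.

(** Both sides of the equivalence describe the same combinatorial data.  Cut
the plane along the diagonals x + y = r.  A north-east path of length k from
the origin is the graph of a height function f, whose value f r is the ordinate
of the path on diagonal r; it starts at 0 and each step raises it by 0 or 1 (a
[staircase]).  A [profile] is a pair of staircases U, D of the same length k > 1
with the same final value and D < U strictly in between.  It determines the set
of points squeezed between D and U on every diagonal ([region]), and the set of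
unit squares all of whose vertices lie there.  Such a square is recognised on
the diagonal through its two middle vertices alone ([between]).

From the paths of a parallelogram polyomino one reads off two staircases.  On a
common diagonal the two heights never agree at an interior index, and their
difference changes by at most 1 from one diagonal to the next, so it keeps a
constant sign; a single cell between the paths forces this sign to be positive
([profile_of_parallelogram_paths]).  Conversely, the cells under an east step of
the upper path and over an east step of the lower one are the cells of the
profile ([cell_between_latticeP], a discrete intermediate value argument).  This
gives [parallelogram_polyominoP].

In a planar distributive lattice L with top element t, the existence of
saturated chains makes the rank of a point equal to its diagonal
([elt_rank_planar]), and the rank of L equal to that of t.  Let U r and D r be
the largest and the smallest ordinate of L on diagonal r.  Every element other
than t has an upper neighbour in L and every nonzero element a lower one, so U
and D are staircases; simplicity says exactly that D < U strictly inside.  The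
lattice contains everything in between ([planar_diag_convex]): from two points
on one diagonal, the meet, the saturated chains along the two sides leaving the
meet, and joins fill the whole triangle.  So L is the region of a profile.
Conversely the region of a profile is closed under meet and join, has saturated
chains, carries two distinct points on every interior diagonal, and is covered
by its cells ([region_simple_planar], [region_vertices]).  This gives
[simple_planar_latticeP].

The theorem compares the two characterisations.  In the backward direction the
collection Q contains the cell at the origin, so the vector from Q to P has
nonnegative coordinates and the paths of Q can be translated inside the
quadrant. *)

Set Implicit Arguments.
Unset Strict Implicit.
Unset Printing Implicit Defensive.

Import Order.Theory.

Local Open Scope fset_scope.
Local Open Scope nat_scope.

(** * Points of the quadrant *)

(** Coordinates of a point of the product order are typed through the order
structure of nat; arithmetic decision procedures need them at type nat.  The hook
below performs this change before the treatment of booleans. *)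
Ltac nat_coords :=
  change (@fst (Order.Preorder.sort _) (Order.Preorder.sort _))
    with (@fst nat nat) in *;
  change (@snd (Order.Preorder.sort _) (Order.Preorder.sort _))
    with (@snd nat nat) in *.

Ltac Zify.zify_pre_hook ::=
  nat_coords; unfold is_true in *; do ?rewrite -> unfold_in in *.

Lemma point_leE (p q : point) : (p <= q)%O = (p.1 <= q.1) && (p.2 <= q.2).
Proof. by rewrite leEprod. Qed.

Lemma point_eqE (p q : point) : (p == q) = (p.1 == q.1) && (p.2 == q.2).
Proof. by case: p q => [a b] [c d]. Qed.

Lemma point_ltE (p q : point) :
  (p < q)%O = [&& p.1 <= q.1, p.2 <= q.2 & p.1 + p.2 < q.1 + q.2].
Proof. rewrite lt_neqAle point_leE point_eqE; lia. Qed.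

Lemma point_meetE (p q : point) :
  Order.meet p q = (minn p.1 q.1, minn p.2 q.2) :> point.
Proof. by rewrite meetEprod !meetEtotal !minEnat. Qed.

Lemma point_joinE (p q : point) :
  Order.join p q = (maxn p.1 q.1, maxn p.2 q.2) :> point.
Proof. by rewrite joinEprod !joinEtotal !maxEnat. Qed.

Lemma point_eqP (p q : point) : p.1 = q.1 -> p.2 = q.2 -> p = q.
Proof. by case: p q => [a b] [c d] /= -> ->. Qed.

Lemma in_cell_vertices (p a : point) :
  p \in cell_vertices a = (a.1 <= p.1 <= a.1.+1) && (a.2 <= p.2 <= a.2.+1).
Proof. rewrite !inE !point_eqE /=; lia. Qed.

(** * Staircases *)

(** The heights, on the diagonals 0 to k, of a north-east path from the origin:
a constant step is an east step, an increasing one a north step. *)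
Definition staircase (k : nat) (f : nat -> nat) : Prop :=
  f 0 = 0 /\ forall r, r < k -> f r <= f r.+1 <= (f r).+1.

Lemma staircase_gap k f r s :
  staircase k f -> r <= s <= k -> f r <= f s <= f r + (s - r).
Proof.
move=> [_ step]; elim: s => [|s IH] rsk.
  have -> : r = 0 by lia.
  lia.
have [->|rs] := eqVneq r s.+1; first lia.
have := step s; lia.
Qed.

Lemma staircase_le k f r : staircase k f -> r <= k -> f r <= r.
Proof. by move=> sf rk; have := staircase_gap (r := 0) (s := r) sf; case: sf; lia. Qed.

(** Intermediate value property of the abscissa r - f r, which also grows by 0
or 1 at each step: it leaves every value it passes by an east step. *)
Lemma staircase_crossing k f a b x :
  staircase k f -> a <= b <= k -> a - f a <= x < b - f b ->
  exists i, [/\ a <= i < b, f i + x = i & f i.+1 = f i].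
Proof.
move=> sf; elim: b => [|b IH] abk axb; first lia.
have [ab|ab] := eqVneq a b.+1; first by subst; lia.
have le_b := staircase_le (r := b) sf.
have le_b1 := staircase_le (r := b.+1) sf.
have stepb := sf.2 b.
have [xb|xb] := ltnP x (b - f b); last by exists b; split; lia.
by case: IH => [||i [*]]; [lia|lia|exists i; split; lia].
Qed.

Definition lattice_point (w : point) (f : nat -> nat) (r : nat) : point :=
  shift w (r - f r, f r).

Definition lattice_path (w : point) (k : nat) (f : nat -> nat) : seq point :=
  map (lattice_point w f) (iota 0 k.+1).

Lemma size_lattice_path w k f : size (lattice_path w k f) = k.+1.
Proof. by rewrite size_map size_iota. Qed.

Lemma nth_lattice_path w k f r :
  r <= k -> nth origin (lattice_path w k f) r = lattice_point w f r.
Proof. by move=> rk; rewrite (nth_map 0) ?size_iota // nth_iota. Qed.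

Lemma head_lattice_path w k f : f 0 = 0 -> head origin (lattice_path w k f) = w.
Proof.
by case: w => a b f0; rewrite /= /lattice_point /shift /= f0 subn0 !addn0.
Qed.

Lemma last_lattice_path w k f :
  last origin (lattice_path w k f) = lattice_point w f k.
Proof. by rewrite -nth_last size_lattice_path nth_lattice_path. Qed.

Lemma ne_path_lattice_path w k f : staircase k f -> ne_path (lattice_path w k f).
Proof.
move=> sf; apply/andP; split=> //; apply/(sortedP origin) => i.
rewrite size_lattice_path => ik; rewrite !nth_lattice_path; [|lia|lia].
have := sf.2 i; have := staircase_le (r := i) sf.
by rewrite /ne_step !point_eqE /=; lia.
Qed.

(** Every step adds 1 to the sum of the coordinates, so a path is recovered from
its first point and its ordinates. *)
Lemma ne_path_staircase S : ne_path S ->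
  exists2 f, staircase (size S).-1 f &
    S = lattice_path (head origin S) (size S).-1 f.
Proof.
case: S => [//|w S] /andP[_ /(sortedP origin) step].
set N := nth origin (w :: S); set k := (size (w :: S)).-1.
have stepN i : i < k ->
    N i.+1 = shift (1, 0) (N i) \/ N i.+1 = shift (0, 1) (N i).
  by move=> ik; have /orP[/eqP|/eqP] := step i ik; [left|right].
have low r : r <= k -> [/\ w.1 <= (N r).1, w.2 <= (N r).2 &
                           (N r).1 + (N r).2 = w.1 + w.2 + r].
  elim: r => [|r IH] rk; first by rewrite /N /=; split; lia.
  by have [|? ? ?] := IH; [lia|case: (stepN r rk) => -> /=; split; lia].
exists (fun r => (N r).2 - w.2).
  split=> [|r rk]; first by rewrite /N /= subnn.
  have [|? ? ?] := low r; first lia.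
  by case: (stepN r rk) => -> /=; lia.
apply: (@eq_from_nth _ origin); first by rewrite size_lattice_path.
move=> r rk; rewrite nth_lattice_path //.
by have [|? ? ?] := low r; [|apply: point_eqP => /=; rewrite -/N; lia].
Qed.

(** * Profiles and parallelogram polyominoes *)

Lemma infix_pairP (T : eqType) (x0 a b : T) (S : seq T) :
  infix [:: a; b] S <->
  exists i, [/\ i.+1 < size S, nth x0 S i = a & nth x0 S i.+1 = b].
Proof.
split=> [/infixP[s [s' ->]]|[i [iS <- <-]]].
  exists (size s); split; first by rewrite !size_cat /=; lia.
    by rewrite nth_cat ltnn subnn.
  by rewrite nth_cat ltnNge leqnSn subSnn.
apply/infixP; exists (take i S), (drop i.+2 S).
rewrite /= -(drop_nth x0 iS) -(drop_nth x0 (ltnW iS)).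
by rewrite cat_take_drop.
Qed.

Lemma east_step_latticeP w k f x h : staircase k f ->
  east_step_at (lattice_path w k f) x h <->
  exists i, [/\ i < k, f i.+1 = f i, h = w.2 + f i & x = w.1 + (i - f i)].
Proof.
move=> sf; rewrite /east_step_at (infix_pairP origin) size_lattice_path.
split=> [[i []]|[i [ik eq_f -> ->]]].
  move=> ik; rewrite !nth_lattice_path; [|lia|lia].
  by move=> [E1 E2] [E3 E4]; exists i; split=> //; lia.
have fi := staircase_le (r := i) sf.
exists i; rewrite !nth_lattice_path; [|lia|lia].
by split; [|apply: point_eqP => /=..]; lia.
Qed.

(** The bound 1 < k makes room for at least one cell. *)
Definition profile (k : nat) (U D : nat -> nat) : Prop :=
  [/\ staircase k U, staircase k D, U k = D k, 1 < k &
      forall r, 0 < r < k -> D r < U r].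

(** The cell with lower left corner a has its upper left and lower right
vertices on the diagonal a.1 + a.2 + 1.  Requiring these two to lie between D
and U is enough: the other two vertices follow from the step condition. *)
Definition between (k : nat) (U D : nat -> nat) (a : point) : bool :=
  ((a.1 + a.2).+1 < k) && (D (a.1 + a.2).+1 <= a.2 < U (a.1 + a.2).+1).

(** The upper path crosses the vertical strip of a cell a on the middle
diagonal of a or beyond it exactly when U is above a on that diagonal, since the
abscissa is monotone along the path; likewise for the lower path, crossing
strictly before that diagonal. *)
Lemma cell_between_latticeP w k U D a : profile k U D ->
  cell_between (lattice_path w k U) (lattice_path w k D) a <->
  exists2 b, a = shift w b & between k U D b.
Proof.
move=> [sU sD ends _ _]; split.
  move=> [h1 [h2 [/(east_step_latticeP _ _ _ sU) [i [ik Ui hi xi]]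
                  /(east_step_latticeP _ _ _ sD) [j [jk Dj hj xj]] le1 le2]]].
  exists (a.1 - w.1, a.2 - w.2); first by apply: point_eqP => /=; lia.
  rewrite /between /=; set r := (_ + _).+1.
  have iU := staircase_le (r := i) sU; have jD := staircase_le (r := j) sD.
  have gU := staircase_gap (r := r) (s := i) sU.
  have gD := staircase_gap (r := j.+1) (s := r) sD.
  have rk : r < k by lia.
  lia.
move=> [[x y]] -> /and3P[/= rk Dr Ur].
have kU := staircase_le (r := k) sU.
have rD := staircase_le (r := (x + y).+1) sD.
have rU := staircase_le (r := (x + y).+1) sU.
have gD := staircase_gap (r := (x + y).+1) (s := k) sD.
have [||i [ir Ui1 Ui2]] := @staircase_crossing k U (x + y).+1 k x sU; [lia|lia|].
have [||j [jr Dj1 Dj2]] := @staircase_crossing k D 0 (x + y).+1 x sD; [lia|lia|].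
exists (w.2 + U i), (w.2 + D j); split=> /=; [| |lia|lia].
- by apply/(east_step_latticeP _ _ _ sU); exists i; split=> //; lia.
- by apply/(east_step_latticeP _ _ _ sD); exists j; split=> //; lia.
Qed.

(** Points of the two paths with the same abscissa need not be on the same
diagonal, but if the point of the lower path were at least as high it would come
later, while the lower path was already strictly to the right of that abscissa
on the diagonal of the upper point. *)
Lemma parallelogram_paths_of_profile w k U D : profile k U D ->
  parallelogram_paths (lattice_path w k U) (lattice_path w k D).
Proof.
move=> [sU sD ends k1 DU]; split.
- by split; exact: ne_path_lattice_path.
- by rewrite !size_lattice_path.
- by rewrite !head_lattice_path; [|exact: sD.1|exact: sU.1].
- by rewrite !last_lattice_path /lattice_point ends.
move=> i j; rewrite !size_lattice_path /= => ik jk.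
rewrite !nth_lattice_path; [|lia|lia] => /= eqx.
have := DU i ik; have := staircase_gap (r := i) (s := j) sD.
have := staircase_le (r := i) sU; have := staircase_le (r := i) sD.
have := staircase_le (r := j) sD; lia.
Qed.

(** The cell rules out the degenerate configurations in which [lies_above] holds
vacuously while the first path is below the second one. *)
Lemma profile_of_parallelogram_paths w k U D a :
  staircase k U -> staircase k D ->
  parallelogram_paths (lattice_path w k U) (lattice_path w k D) ->
  cell_between (lattice_path w k U) (lattice_path w k D) a ->
  profile k U D.
Proof.
move=> sU sD [_ _ _ ends above].
rewrite !last_lattice_path in ends; have Uk : U k = D k by case: ends; lia.
have neq r : 0 < r < k -> D r <> U r.
  move=> rk eqr; have := above r r; rewrite !size_lattice_path.
  rewrite !nth_lattice_path /= ?eqr; [|lia|lia]; lia.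
move=> [h1 [h2 [/(east_step_latticeP _ _ _ sU) [i [ik Ui hi xi]]
                /(east_step_latticeP _ _ _ sD) [j [jk Dj hj xj]] le1 le2]]].
have iU := staircase_le (r := i) sU; have jD := staircase_le (r := j) sD.
have gD := staircase_gap (r := j.+1) (s := i) sD.
(* On the diagonal where the upper path leaves abscissa x, the lower path, which
   left it earlier, is strictly to the right, hence strictly lower. *)
have DUi : D i < U i by lia.
have i0 : 0 < i < k by lia.
split=> //; first lia.
(* The difference of heights cannot jump over 0, so its positivity spreads from
   diagonal i to all interior diagonals on both sides. *)
move=> r rk; have [ri|ir] := leqP r i.
  elim: {r}(i - r) {-2}r (erefl (i - r)) ri rk => [|n IH] r; first by move=> ? ? ?; have -> : r = i by lia.
  move=> E ri rk; have := IH r.+1; have := neq r rk.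
  by have := sU.2 r; have := sD.2 r; lia.
elim: r ir rk => [|r IH] ir rk; first lia.
have := neq r.+1 rk; have := sU.2 r; have := sD.2 r.
have [<-|?] := eqVneq i r; lia.
Qed.

Lemma parallelogram_polyominoP (P : {fset point}) : P <> fset0 ->
  parallelogram_polyomino P <->
  exists w k U D, profile k U D /\
    forall a, a \in P <-> exists2 b, a = shift w b & between k U D b.
Proof.
move=> /eqP/fset0Pn[a0 a0P]; split.
  move=> [S1 [S2 [paths cells]]].
  have [[ne1 ne2] eqs eqh _ _] := paths.
  have [U sU E1] := ne_path_staircase ne1.
  have [D sD E2] := ne_path_staircase ne2.
  rewrite -eqs -eqh in sD E2.
  move: E1 E2 sU sD; set w := head _ _; set k := _.-1 => E1 E2 sU sD.
  have /cells := a0P; rewrite E1 E2 in paths cells *.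
  move=> /(profile_of_parallelogram_paths sU sD paths) pr.
  exists w, k, U, D; split=> // a; rewrite cells.
  exact: cell_between_latticeP.
move=> [w [k [U [D [pr cells]]]]].
exists (lattice_path w k U), (lattice_path w k D); split.
  exact: parallelogram_paths_of_profile.
by move=> a; rewrite cells; split=> /(cell_between_latticeP _ _ pr).
Qed.

(** * Ranks in planar distributive lattices *)

Definition diag (p : point) : nat := p.1 + p.2.

Lemma unit_ltE (p q : point) :
  unit_lt p q = (p <= q)%O && (diag q == (diag p).+1).
Proof. by rewrite /unit_lt point_ltE point_leE /diag; lia. Qed.

Lemma chainP (C : {fset point}) :
  reflect (forall p q, p \in C -> q \in C -> (p >=< q)%O) (chain C).
Proof.
apply: (iffP forallP) => [ch p q pC qC|ch p].
  by have /forallP/(_ [` qC]) := ch [` pC].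
by apply/forallP => q; apply: ch; apply: valP.
Qed.

Lemma descends_fromP a (C : {fset point}) :
  reflect (a \in C /\ forall p, p \in C -> (p <= a)%O) (descends_from a C).
Proof.
apply: (iffP andP) => [[aC /forallP le_a]|[aC le_a]]; split=> //.
  by move=> p pC; have := le_a [` pC].
by apply/forallP => p; apply: le_a; apply: valP.
Qed.

(** Two comparable points on the same diagonal are equal, so a chain has at most
one point on each diagonal. *)
Lemma card_chain_le (C : {fset point}) n :
  chain C -> (forall p, p \in C -> diag p <= n) -> #|` C| <= n.+1.
Proof.
move=> /chainP ch le_n.
rewrite -(size_map diag) -(size_iota 0 n.+1); apply: uniq_leq_size.
  rewrite map_inj_in_uniq ?fset_uniq // => p q pC qC.
  have := ch p q pC qC; rewrite /Order.comparable !point_leE /diag.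
  by move=> ? ?; apply: point_eqP; lia.
by move=> r /mapP[p /le_n pn ->]; rewrite mem_iota.
Qed.

Section PlanarLattice.

Variable L : {fset point}.
Hypothesis planarL : planar_distributive_lattice L.

Lemma planar_succ p q : p \in L -> q \in L -> (p < q)%O ->
  exists p', [/\ p' \in L, unit_lt p p' & (p' <= q)%O].
Proof.
move=> pL qL pq; have [_ _ /(_ p q pL qL pq)[[|p' s] [/=]]] := planarL.
  by move=> _ E; rewrite E ltxx in pq.
move=> /andP[pp' path_s] last_s /andP[p'L _]; exists p'; split=> //.
rewrite -last_s; elim: s p' path_s {last_s pp' p'L} => [|x s IH] y //=.
by move=> /andP[/andP[/ltW yx _] /IH]; apply: le_trans.
Qed.

Lemma planar_pred p q : p \in L -> q \in L -> (p < q)%O ->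
  exists q', [/\ q' \in L, unit_lt q' q & (p <= q')%O].
Proof.
have [n le_n] := ubnP (diag q - diag p).
elim: n => // n IH in p le_n *; move=> pL qL pq.
have [p' [p'L pp' p'q]] := planar_succ pL qL pq.
have := pp'; rewrite unit_ltE => /andP[le_pp' /eqP Ep'].
move: p'q; rewrite le_eqVlt => /orP[/eqP <-|p'q]; first by exists p.
have [|q' [q'L q'q p'q']] := IH p' _ p'L qL p'q.
  by move: (p'q); rewrite point_ltE /diag in Ep' le_n *; lia.
by exists q'; split=> //; apply: le_trans p'q'.
Qed.

(** This chain meets every diagonal up to that of p, which makes the bound of
[card_chain_le] sharp. *)
Lemma planar_saturated_chain p : p \in L ->
  exists C : {fset point},
    [/\ C `<=` L, chain C, descends_from p C & #|` C| = (diag p).+1].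
Proof.
have [_ oL _] := planarL.
have [n] := ubnP (diag p); elim: n p => // n IH p pn pL.
have [->|p0] := eqVneq p origin.
  exists [fset origin]; split; rewrite ?cardfs1 ?fsub1set //.
    by apply/chainP => q r; rewrite !inE => /eqP-> /eqP->; rewrite /Order.comparable lexx.
  apply/descends_fromP; rewrite inE eqxx; split=> // q; rewrite inE => /eqP->.
  exact: lexx.
have [|q [qL]] := planar_pred oL pL.
  by move: p0; rewrite point_ltE point_eqE /=; lia.
rewrite unit_ltE => /andP[qp /eqP Ep] _.
have [|C [CL /chainP ch /descends_fromP[qC le_q] szC]] := IH q _ qL; first lia.
have le_p r : r \in C -> (r <= p)%O by move=> /le_q rq; apply: le_trans qp.
have pC : p \notin C by apply/negP => /le_q; rewrite point_leE /diag in Ep *; lia.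
exists (p |` C); split.
- by apply/fsubsetP => r; rewrite !inE => /orP[/eqP->|/(fsubsetP CL)].
- apply/chainP => r s; rewrite !inE /Order.comparable.
  move=> /orP[/eqP->|rC] /orP[/eqP->|sC]; rewrite ?lexx ?le_p ?orbT //.
  exact: ch.
- apply/descends_fromP; split=> [|r]; rewrite !inE ?eqxx //.
  by move=> /orP[/eqP->|/le_p].
by rewrite cardfsU1 pC szC Ep.
Qed.

Lemma elt_rank_planar p : p \in L -> elt_rank L p = diag p.
Proof.
move=> pL; apply/eqP; rewrite eqn_leq; apply/andP; split.
  apply/bigmax_leqP_seq => C; rewrite fpowersetE => CL.
  move=> /andP[ch /descends_fromP[_ le_p]].
  have := card_chain_le (n := diag p) ch; rewrite /chain_length.
  case: #|` C| => // c; apply=> q /le_p; rewrite point_leE /diag; lia.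
have [C [CL ch dp szC]] := planar_saturated_chain pL.
have -> : diag p = chain_length C by rewrite /chain_length szC.
by apply: leq_bigmax_seq; rewrite ?fpowersetE ?ch.
Qed.

Lemma lattice_rank_planar t :
  t \in L -> (forall p, p \in L -> (p <= t)%O) -> lattice_rank L = diag t.
Proof.
move=> tL le_t; apply/eqP; rewrite eqn_leq; apply/andP; split.
  apply/bigmax_leqP_seq => C; rewrite fpowersetE => /fsubsetP CL ch.
  have := card_chain_le (n := diag t) ch; rewrite /chain_length.
  by case: #|` C| => // c; apply=> q /CL/le_t; rewrite point_leE /diag; lia.
have [C [CL ch _ szC]] := planar_saturated_chain tL.
have -> : diag t = chain_length C by rewrite /chain_length szC.
by apply: leq_bigmax_seq; rewrite ?fpowersetE.
Qed.

Lemma planar_top : exists2 t, t \in L & forall p, p \in L -> (p <= t)%O.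
Proof.
have [subL oL _] := planarL.
suff [t tL le_t] : exists2 t, t \in L & forall p, p \in (L : seq point) -> (p <= t)%O.
  by exists t.
have : {subset (L : seq point) <= L} by [].
elim: (L : seq point) => [|p s IH] sL; first by exists origin.
have [|t tL le_t] := IH; first by move=> q qs; apply: sL; rewrite inE qs orbT.
have [_ join_pt] := subL _ _ (sL p (mem_head p s)) tL.
exists (Order.join p t) => // q; rewrite inE => /orP[/eqP->|/le_t qt].
  exact: leUl.
exact: le_trans (leUr _ _).
Qed.

(** * Planar distributive lattices are diagonally convex *)

(** A chain of unit steps between two points on a vertical line has to stay on
that line. *)
Lemma planar_vertical x m j y :
  (x, m) \in L -> (x, j) \in L -> m <= y <= j -> (x, y) \in L.
Proof.
move=> pL qL /andP[my yj].
elim: y my yj => [|y IH] my yj; first by have -> : 0 = m by lia.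
have [->//|my1] := eqVneq y.+1 m.
have yL : (x, y) \in L by apply: IH; lia.
have [|z [zL]] := planar_succ yL qL; first by rewrite point_ltE /=; lia.
rewrite unit_ltE !point_leE /diag /= => ? ?.
by have <- : z = (x, y.+1) by apply: point_eqP => /=; lia.
Qed.

Lemma planar_horizontal y m j x :
  (m, y) \in L -> (j, y) \in L -> m <= x <= j -> (x, y) \in L.
Proof.
move=> pL qL /andP[mx xj].
elim: x mx xj => [|x IH] mx xj; first by have -> : 0 = m by lia.
have [->//|mx1] := eqVneq x.+1 m.
have xL : (x, y) \in L by apply: IH; lia.
have [|z [zL]] := planar_succ xL qL; first by rewrite point_ltE /=; lia.
rewrite unit_ltE !point_leE /diag /= => ? ?.
by have <- : z = (x.+1, y) by apply: point_eqP => /=; lia.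
Qed.

(** With u = (a, b) and d = (c, e), the meet (a, e) is in L, hence so are the
vertical side from (a, e) to u and the horizontal side from (a, e) to d; the
point p = (x, y) is the join of (a, y) and (x, e). *)
Lemma planar_diag_convex u d p :
  u \in L -> d \in L -> diag u = diag d -> diag p = diag d ->
  d.2 <= p.2 <= u.2 -> p \in L.
Proof.
case: u d p => [a b] [c e] [x y]; rewrite /diag /= => uL dL Eu Ep ye.
have [subL _ _] := planarL.
have [] := subL _ _ uL dL; rewrite point_meetE /=.
have -> : minn a c = a by lia.
have -> : minn b e = e by lia.
move=> mL _.
have aL : (a, y) \in L by apply: (planar_vertical mL uL); lia.
have eL : (x, e) \in L by apply: (planar_horizontal mL dL); lia.
have [_] := subL _ _ aL eL; rewrite point_joinE /=.
have -> : maxn a x = x by lia.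
by have -> : maxn y e = y by lia.
Qed.

End PlanarLattice.

(** * The profile of a simple planar distributive lattice *)

Definition region (k : nat) (U D : nat -> nat) (p : point) : bool :=
  (diag p <= k) && (D (diag p) <= p.2 <= U (diag p)).

Definition upper (L : {fset point}) (r : nat) : nat :=
  \max_(p <- L | diag p == r) p.2.

(** On diagonal r the smallest ordinate is r minus the largest abscissa; with
maxima on both sides, the two extremal ordinates are treated alike. *)
Definition lower (L : {fset point}) (r : nat) : nat :=
  r - \max_(p <- L | diag p == r) p.1.

Lemma bigmax_seq_attained (I : eqType) (s : seq I) (P : pred I) (F : I -> nat) :
  has P s -> exists i, [/\ i \in s, P i & F i = \max_(j <- s | P j) F j].
Proof.
elim: s => //= a s IH; rewrite big_cons; case: (boolP (has P s)) => [/IH|nPs].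
  move=> [i [iS Pi Ei]] _; case: ifP => Pa; last by exists i; rewrite inE iS orbT.
  have [le|lt] := leqP (F a) (\max_(j <- s | P j) F j).
    by exists i; rewrite inE iS orbT Ei; split=> //; lia.
  by exists a; rewrite mem_head; split=> //; lia.
rewrite orbF => Pa; rewrite Pa big_hasC // maxn0.
by exists a; rewrite mem_head.
Qed.

Lemma le_upper (L : {fset point}) (p : point) : p \in L -> p.2 <= upper L (diag p).
Proof.
by move=> pL; apply: (@leq_bigmax_seq _ (L : seq _) (fun q => diag q == diag p) snd).
Qed.

Lemma ge_lower (L : {fset point}) (p : point) : p \in L -> lower L (diag p) <= p.2.
Proof.
move=> pL; rewrite /lower.
have : p.1 <= \max_(q <- L | diag q == diag p) q.1.
  by apply: (@leq_bigmax_seq _ (L : seq _) (fun q => diag q == diag p) fst).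
by set m := \max_(_ <- _ | _) _; rewrite /diag; lia.
Qed.

Lemma upper_attained (L : {fset point}) (p : point) : p \in L ->
  exists u : point, [/\ u \in L, diag u = diag p & u.2 = upper L (diag p)].
Proof.
move=> pL; have hasP : has (fun q => diag q == diag p) L.
  by apply/hasP; exists p.
by have [u [uL /eqP ? ?]] := bigmax_seq_attained (fun q : point => q.2) hasP; exists u.
Qed.

Lemma lower_attained (L : {fset point}) (p : point) : p \in L ->
  exists d : point, [/\ d \in L, diag d = diag p & d.2 = lower L (diag p)].
Proof.
move=> pL; have hasP : has (fun q => diag q == diag p) L.
  by apply/hasP; exists p.
have [d [dL /eqP Ed /= max_d]] := bigmax_seq_attained (fun q : point => q.1) hasP.
by exists d; split=> //; rewrite /lower -max_d -Ed /diag; lia.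
Qed.

(** Neighbours in L, obtained by moving towards t or towards the origin, bound
the variation of the extremal ordinates between consecutive diagonals;
simplicity provides the points on each diagonal and the strict inequality. *)
Lemma simple_planar_region (L : {fset point}) (t : point) :
  simple_planar_distributive_lattice L ->
  t \in L -> (forall p, p \in L -> (p <= t)%O) -> 1 < diag t ->
  profile (diag t) (upper L) (lower L) /\
  forall p, (p \in L) = region (diag t) (upper L) (lower L) p.
Proof.
move=> [pL sL] tL le_t t1; set k := diag t; set U := upper L; set D := lower L.
have [_ oL _] := pL.
have diag_t p : p \in L -> diag p <= k.
  by move=> /le_t; rewrite point_leE /k /diag; lia.
have occupied r : r <= k -> exists2 p, p \in L & diag p = r.
  move=> rk; have [->|r0] := eqVneq r 0; first by exists origin.
  have [->|rneqk] := eqVneq r k; first by exists t.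
  have := sL r; rewrite (lattice_rank_planar pL tL le_t).
  have [->|[p]] := fset_0Vmem [fset a in L | elt_rank L a == r].
    by rewrite cardfs0; lia.
  by rewrite !inE /= => /andP[pinL]; rewrite elt_rank_planar // => /eqP; exists p.
have hasU r : r <= k -> exists u : point, [/\ u \in L, diag u = r & u.2 = U r].
  by move=> /occupied[p /upper_attained[u [? ? ?]] <-]; exists u.
have hasD r : r <= k -> exists d : point, [/\ d \in L, diag d = r & d.2 = D r].
  by move=> /occupied[p /lower_attained[u [? ? ?]] <-]; exists u.
have leU (p : point) : p \in L -> p.2 <= U (diag p) by apply: le_upper.
have geD (p : point) : p \in L -> D (diag p) <= p.2 by apply: ge_lower.
have succ (p : point) : p \in L -> diag p < k ->
    exists q : point, [/\ q \in L, diag q = (diag p).+1 & p.2 <= q.2 <= p.2.+1].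
  move=> pinL pk; have [|q [qL]] := planar_succ pL pinL tL.
    by have := le_t p pinL; rewrite point_ltE point_leE /k /diag in pk *; lia.
  rewrite unit_ltE point_leE => /andP[? /eqP Eq] _; exists q; split=> //.
  by rewrite /diag in Eq; lia.
have pred (q : point) : q \in L -> 0 < diag q ->
    exists p : point, [/\ p \in L, diag q = (diag p).+1 & p.2 <= q.2 <= p.2.+1].
  move=> qinL q0; have [|p [pinL]] := planar_pred pL oL qinL.
    by rewrite point_ltE /diag in q0 *; rewrite /=; lia.
  rewrite unit_ltE point_leE => /andP[? /eqP Eq] _; exists p; split=> //.
  by rewrite /diag in Eq; lia.
have Uo : U 0 = 0 by have [//|u [_]] := hasU 0; rewrite /diag => ? <-; lia.
have Do : D 0 = 0 by have [//|u [_]] := hasD 0; rewrite /diag => ? <-; lia.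
split; last first.
  move=> p; apply/idP/idP => [pinL|/and3P[pk Dp Up]].
    by rewrite /region diag_t // leU // geD.
  have [u [uL Eu u2]] := hasU _ pk; have [d [dL Ed d2]] := hasD _ pk.
  by apply: (planar_diag_convex pL uL dL); rewrite ?Eu ?Ed // d2 u2 Dp.
split=> //.
- split=> // r rk.
  have [|u [uL Eu u2]] := hasU r; first lia.
  have [|v [vL Ev v2]] := hasU r.+1; first lia.
  have [|u' [u'L Eu' ?]] := succ u uL; first lia.
  have [|v' [v'L Ev' ?]] := pred v vL; first lia.
  have := leU u' u'L; have := leU v' v'L; rewrite Eu' Eu.
  have -> : diag v' = r by lia.
  lia.
- split=> // r rk.
  have [|u [uL Eu u2]] := hasD r; first lia.
  have [|v [vL Ev v2]] := hasD r.+1; first lia.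
  have [|u' [u'L Eu' ?]] := succ u uL; first lia.
  have [|v' [v'L Ev' ?]] := pred v vL; first lia.
  have := geD u' u'L; have := geD v' v'L; rewrite Eu' Eu.
  have -> : diag v' = r by lia.
  lia.
- have [//|u [/le_t ut Eu <-]] := hasU k.
  have [//|d [/le_t dt Ed <-]] := hasD k.
  by rewrite !point_leE /k /diag in ut dt Eu Ed *; lia.
move=> r rk; rewrite ltnNge; apply/negP => UD.
have [|u [uL Eu u2]] := hasU r; first lia.
have := sL r; rewrite (lattice_rank_planar pL tL le_t) => /(_ rk).
suff /fsubset_leq_card : [fset a in L | elt_rank L a == r] `<=` [fset u].
  by rewrite cardfs1; lia.
apply/fsubsetP => p; rewrite !inE /= => /andP[pinL].
rewrite elt_rank_planar // => /eqP Ep; have := leU p pinL; have := geD p pinL.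
by rewrite Ep point_eqE; rewrite /diag in Ep Eu; lia.
Qed.

(** * The region of a profile is a simple planar distributive lattice *)

Section Region.

Variables (k : nat) (U D : nat -> nat).
Hypothesis pr : profile k U D.

Lemma regionE x y :
  region k U D (x, y) = (x + y <= k) && (D (x + y) <= y <= U (x + y)).
Proof. by []. Qed.

Lemma between_origin : between k U D origin.
Proof.
case: pr => sU sD _ k1 DU; rewrite /between /= addn0.
by have := DU 1; have := staircase_le (r := 1) sU; lia.
Qed.

Lemma profile_le r : r <= k -> D r <= U r.
Proof.
case: pr => sU sD ends _ DU rk.
have [->|r0] := eqVneq r 0; first by rewrite sU.1 sD.1.
have [->|?] := eqVneq r k; first by rewrite ends.
by apply/ltnW/DU; lia.
Qed.

Lemma cell_in_regionP a :
  between k U D a <-> forall p, p \in cell_vertices a -> region k U D p.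
Proof.
case: pr => sU sD ends k1 DU; case: a => x y.
have stepU := sU.2 (x + y); have stepU1 := sU.2 (x + y).+1.
have stepD := sD.2 (x + y); have stepD1 := sD.2 (x + y).+1.
split=> [/and3P[/= xyk Dxy Uxy] [a b]|in_reg].
  rewrite in_cell_vertices regionE /= => ab.
  have [|[|]] : a + b = x + y \/ a + b = (x + y).+1 \/ a + b = (x + y).+2 by lia.
  - by move=> E; rewrite E; lia.
  - by move=> E; rewrite E; lia.
  - by move=> E; rewrite E; lia.
have := in_reg (x, y.+1); have := in_reg (x.+1, y); have := in_reg (x.+1, y.+1).
rewrite !in_cell_vertices !regionE /between /= !addnS !addSn.
lia.
Qed.

(** Every point of the region is a vertex of one of its cells: at an interior
diagonal there is room either to the upper left or to the lower right of the
point, and the two extremal points are corners of the first and last cells. *)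
Lemma region_vertices (Q : {fset point}) :
  (forall a, a \in Q <-> between k U D a) ->
  forall p, (p \in vertices Q) = region k U D p.
Proof.
move=> cells p; apply/bigfcupP/idP => [[a /andP[/cells/cell_in_regionP ina _]]|].
  exact: ina.
case: p => x y; rewrite regionE => /and3P[xyk Dxy Uxy].
suff [a b_a p_a] : exists2 a, between k U D a & (x, y) \in cell_vertices a.
  by exists a; rewrite // andbT; apply/cells.
case: pr => sU sD ends k1 DU.
have [xy0|xy0] := eqVneq (x + y) 0.
  by exists origin; [exact: between_origin|rewrite in_cell_vertices /=; lia].
have [xy_k|xy_k] := eqVneq (x + y) k.
  have Ek : k = k.-1.+1 by lia.
  have := sU.2 k.-1; have := sD.2 k.-1; rewrite -Ek.
  have := DU k.-1; have := staircase_le (r := k.-1) sU; rewrite xy_k in Dxy Uxy.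
  move=> ? ? ? ?; exists (x.-1, y.-1); rewrite ?in_cell_vertices /between /=; last lia.
  have -> : (x.-1 + y.-1).+1 = k.-1 by lia.
  lia.
have DUxy := DU (x + y); have le_U := staircase_le (r := x + y) sU.
have [yU|yU] := ltnP y (U (x + y)).
  exists (x.-1, y); rewrite ?in_cell_vertices /between /=; last lia.
  have -> : (x.-1 + y).+1 = x + y by lia.
  lia.
exists (x, y.-1); rewrite ?in_cell_vertices /between /=; last lia.
have -> : (x + y.-1).+1 = x + y by lia.
lia.
Qed.

(** The common end of the two staircases bounds the join: the abscissa x' is at
most that of the end point because of the lower path, and y at most its ordinate
because of the upper path.  The remaining inequalities say that ordinates and
abscissas are monotone along both paths. *)
Lemma region_sublattice x y x' y' :
  region k U D (x, y) -> region k U D (x', y') -> x <= x' -> y' <= y ->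
  region k U D (x, y') /\ region k U D (x', y).
Proof.
case: pr => sU sD ends _ _.
rewrite !regionE => /and3P[k1 D1 U1] /and3P[k2 D2 U2] xx yy.
have U1k := staircase_gap (r := x + y) (s := k) sU.
have D2k := staircase_gap (r := x' + y') (s := k) sD.
have top : x' + y <= k by lia.
have := staircase_gap (r := x + y) (s := x' + y) sU.
have := staircase_gap (r := x' + y') (s := x' + y) sD.
have := staircase_gap (r := x + y') (s := x + y) sU.
have := staircase_gap (r := x + y') (s := x' + y') sD.
lia.
Qed.

(** Step east if this stays in the region and does not overshoot q.  Otherwise
either the lower path forces a north step, or q is straight above p; in both
cases the north step is available. *)
Lemma region_succ p q : region k U D p -> region k U D q -> (p < q)%O ->
  exists p', [/\ region k U D p', unit_lt p p' & (p' <= q)%O].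
Proof.
case: pr => sU sD _ _ _; case: p q => x y [x' y'].
rewrite !regionE point_ltE /= => /and3P[k1 D1 U1] /and3P[k2 D2 U2] pq.
have stepU := sU.2 (x + y); have stepD := sD.2 (x + y).
have DU := @profile_le (x + y).+1.
have gU := staircase_gap (r := (x + y).+1) (s := x' + y') sU.
have gD := staircase_gap (r := (x + y).+1) (s := x' + y') sD.
have [east|] := boolP ((x < x') && (D (x + y).+1 <= y)).
  exists (x.+1, y); rewrite regionE unit_ltE !point_leE /diag /= addSn.
  by split; lia.
move=> north; exists (x, y.+1); rewrite regionE unit_ltE !point_leE /diag /= addnS.
by split; lia.
Qed.

(** The end point of the two staircases is the top element; on an interior
diagonal r the heights U r and D r give two distinct points of rank r. *)
Lemma region_simple_planar (L : {fset point}) :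
  (forall p, (p \in L) = region k U D p) -> simple_planar_distributive_lattice L.
Proof.
move=> inL; have [sU sD ends k1 DU] := pr.
have planarL : planar_distributive_lattice L.
  split.
  - move=> [x y] [x' y']; rewrite point_meetE point_joinE !inL /= => r1 r2.
    have [xx|xx] := leqP x x'; have [yy|yy] := leqP y y'.
    + by [].
    + by apply: region_sublattice r1 r2 xx _; lia.
    + by have [| |] := region_sublattice r2 r1; [lia|lia|].
    + by [].
  - by rewrite inL regionE /= addn0 sU.1 sD.1.
  move=> p q pL qL; rewrite !inL in pL qL.
  have [n le_n] := ubnP (diag q - diag p).
  elim: n => // n IH in p le_n pL *; move=> pq.
  have [p' [p'L pp' p'q]] := region_succ pL qL pq.
  have := pp'; rewrite unit_ltE => /andP[_ /eqP Ep'].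
  move: p'q; rewrite le_eqVlt => /orP[/eqP <-|p'q].
    by exists [:: p']; rewrite /= pp' inL p'L.
  have [|s [path_s last_s sL]] := IH p' _ p'L p'q.
    by move: (p'q); rewrite point_ltE /diag in Ep' le_n *; lia.
  by exists (p' :: s); rewrite /= pp' inL p'L.
split=> // r.
have le_U s : s <= k -> U s <= s by apply: staircase_le.
have le_D s : s <= k -> D s <= s by apply: staircase_le.
have top_rank : lattice_rank L = k.
  rewrite (lattice_rank_planar (t := (k - U k, U k)) planarL).
  - by rewrite /diag /=; have := le_U k; lia.
  - rewrite inL regionE; have -> : k - U k + U k = k by have := le_U k; lia.
    by rewrite ends; lia.
  move=> [x y]; rewrite inL regionE point_leE /= => /and3P[xyk Dxy Uxy].
  have := staircase_gap (r := x + y) (s := k) sU.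
  by have := staircase_gap (r := x + y) (s := k) sD; lia.
rewrite top_rank => rk; have DUr := DU r rk; have Ur := le_U r; have Dr := le_D r.
have EU : r - U r + U r = r by lia.
have ED : r - D r + D r = r by lia.
pose u : point := (r - U r, U r); pose d : point := (r - D r, D r).
have uL : u \in L by rewrite inL regionE EU; lia.
have dL : d \in L by rewrite inL regionE ED; lia.
have <- : #|` [fset u; d]| = 2 by rewrite cardfs2 point_eqE /=; lia.
apply: fsubset_leq_card; apply/fsubsetP => p; rewrite !inE /=.
by move=> /orP[]/eqP->; rewrite ?uL ?dL elt_rank_planar // /diag /= ?EU ?ED.
Qed.

End Region.

(** * The two characterisations compared *)

Lemma simple_planar_latticeP (Q : {fset point}) : Q <> fset0 ->
  is_simple_planar_distributive_lattice Q <->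
  exists k U D, profile k U D /\ forall a, a \in Q <-> between k U D a.
Proof.
move=> /eqP/fset0Pn[a0 a0Q]; split; last first.
  move=> [k [U [D [pr cells]]]]; have verts := region_vertices pr cells.
  split; first exact: region_simple_planar pr _ verts.
  move=> a; rewrite cells (cell_in_regionP pr); split.
    by move=> in_reg; apply/fsubsetP => p /in_reg; rewrite verts.
  by move=> /fsubsetP sub p /sub; rewrite verts.
move=> [simpleL cells]; have [planarL _] := simpleL.
have [t tL le_t] := planar_top planarL.
have t1 : 1 < diag t.
  have /cells/fsubsetP/(_ (shift (1, 1) a0)) := a0Q.
  rewrite in_cell_vertices /=.
  by move=> /(_ ltac:(lia))/le_t; rewrite point_leE /diag /=; lia.
have [pr verts] := simple_planar_region simpleL tL le_t t1.
exists (diag t), (upper (vertices Q)), (lower (vertices Q)); split=> // a.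
rewrite cells (cell_in_regionP pr); split.
  by move=> /fsubsetP sub p /sub; rewrite verts.
by move=> in_reg; apply/fsubsetP => p /in_reg; rewrite verts.
Qed.

Lemma shift_eqE (u v a b : point) :
  shift u a = shift v b -> u.1 + a.1 = v.1 + b.1 /\ u.2 + a.2 = v.2 + b.2.
Proof. by case. Qed.

Lemma shift_inj u : injective (shift u).
Proof. by move=> p q [E1 E2]; apply: point_eqP; lia. Qed.

(** Since translations are injective, equality of the translated sets transfers
membership pointwise. *)
Lemma translatesE (P Q : {fset point}) u v :
  [fset shift u a | a in P] = [fset shift v b | b in Q] ->
  forall a b, shift u a = shift v b -> (a \in P) = (b \in Q).
Proof.
move=> E a b Eab; apply/idP/idP => [aP|bQ].
  have : shift v b \in [fset shift u a | a in P] by rewrite -Eab in_imfset.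
  by rewrite E => /imfsetP[c cQ /shift_inj ->].
have : shift u a \in [fset shift v b | b in Q] by rewrite Eab in_imfset.
by rewrite -E => /imfsetP[c cP /shift_inj ->].
Qed.

Theorem proposition2p3 (P : {fset point}) (hP : P <> fset0) :
  parallelogram_polyomino P <->
  exists Q : {fset point},
    translates P Q /\ is_simple_planar_distributive_lattice Q.
Proof.
rewrite (parallelogram_polyominoP hP); split.
  move=> [w [k [U [D [pr cells]]]]].
  (* All the cells of P have coordinates at least those of w, so truncated
     subtraction is a genuine translation on P. *)
  pose unshift (a : point) : point := (a.1 - w.1, a.2 - w.2).
  have shiftK : cancel (shift w) unshift.
    by move=> b; apply: point_eqP => /=; lia.
  have inQ b : b \in [fset unshift a | a in P] <-> between k U D b.
    split=> [/imfsetP[a /= /cells[c -> bc] ->]|bb]; first by rewrite shiftK.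
    by apply/imfsetP; exists (shift w b); [apply/cells; exists b|rewrite shiftK].
  exists [fset unshift a | a in P]; split.
    exists origin, w; apply/fsetP => a; have E0 b : shift origin b = b by apply: point_eqP.
    apply/imfsetP/imfsetP => /= [[c /cells[b -> bb] ->]|[b /inQ bb ->]].
      by exists b; [apply/inQ|].
    by exists (shift w b); [apply/cells; exists b|].
  apply/simple_planar_latticeP; last by exists k, U, D.
  by move=> Q0; have /inQ := between_origin pr; rewrite Q0 inE.
move=> [Q [[u [v E]] simpleQ]].
have inPQ := translatesE E.
have Q0 : Q <> fset0.
  move=> Q0; apply: hP; apply/eqP/fset0Pn => -[a aP].
  by have := in_imfset imfset_key (shift u) aP; rewrite E Q0 => /imfsetP[].
have [k [U [D [pr cells]]]] := (simple_planar_latticeP Q0).1 simpleQ.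
(* The cell of P that corresponds to the origin of Q is the starting point of
   the two paths. *)
have /imfsetP[a0 _ Ea0] : shift v origin \in [fset shift u a | a in P].
  by rewrite E in_imfset //; apply/cells/between_origin.
have [/= Ex Ey] := shift_eqE Ea0; rewrite !addn0 in Ex Ey.
exists a0, k, U, D; split=> // a; split=> [aP|[b -> /cells bQ]].
  have := in_imfset imfset_key (shift u) aP; rewrite E => /imfsetP[b /= /cells bQ].
  by move=> /shift_eqE[E1 E2]; exists b => //; apply: point_eqP => /=; lia.
by rewrite (inPQ _ b) //; apply: point_eqP => /=; lia.
Qed.
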